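(* Let $\mathbf{C}$ be a subdirectly irreducible coop with carrier set $C$ and monolithic ideal $M$, and define $$F=\{f\in C : M\subseteq \mathsf{IS}(f)\},\qquad S=\mathsf{IS}(F)=\bigcap_{f\in F}\mathsf{IS}(f).$$ Then: \begin{itemize} \item[(i)] for every $x\in C\setminus\{0\}$ there is $a\in M\setminus\{0\}$ with $x\ge a$; \item[(ii)] for every $f\in F\setminus\{0\}$ and $a\in M$, $f\ge a$; \item[(iii)] for every $a\in M$ and $f\in F\setminus\{0\}$, $a+f=f$; \item[(iv)] for every $f\in F\setminus\{0\}$ and $x\in C$, if $x\ge f$ then $x\in F$; \item[(v)] for every $x\in C$ and $f\in F$, $x\rightarrow f\in F$; \item[(vi)] for every $f\in F\setminus\{0\}$ and $x\in C\setminus F$, $f>x$; \item[(vii)] $F$ is the carrier set of a subcoop $\mathbf{F}$ of $\mathbf{C}$; \item[(viii)] $S$ is a linearly ordered ideal of $\mathbf{C}$, and $S\cap F=\{0\}$; \item[(ix)] writing $\mathbf{S}$ for the subcoop with carrier set $S$, $\mathbf{S}$ is semi-cancellative; \item[(x)] $\mathbf{C}$ is the ordinal sum $\mathbf{S}\frown\mathbf{F}$ of $\mathbf{S}$ and $\mathbf{F}$. \end{itemize}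
   Context: A pocrim is a structure $(M;0,+,\rightarrow)$ with a constant $0$ and binary operations $+,\rightarrow$ such that, writing $x\ge y$ as an abbreviation for $x\rightarrow y=0$: $(x+y)+z=x+(y+z)$, $x+y=y+x$, $x+0=x$; $\ge$ is reflexive, transitive and antisymmetric; $x\ge y$ implies $x+z\ge y+z$; $x\ge 0$; and $x+y\ge z$ iff $x\ge y\rightarrow z$. A hoop is a pocrim that is naturally ordered: whenever $x\ge y$ there is $z$ with $x=y+z$. A coop is a structure $(C;0,+,\rightarrow,/2)$ whose $(0,+,\rightarrow)$-reduct is a hoop and in which $x/2=x/2\rightarrow x$ for all $x$. An ideal of a coop is a subset containing $0$, closed under $+$ and downwards closed for $\le$ (it is then the carrier of a subcoop). Congruences of a coop correspond bijectively to ideals. A coop is subdirectly irreducible iff the intersection of its non-identity congruences is not the identity congruence, equivalently iff the intersection of all its non-zero ideals (ideals other than $\{0\}$) is non-zero; that intersection $M$ is its monolithic ideal. For $x\in C$, the implicative stabilizer is $\mathsf{IS}(x)=\{s\in C : s\rightarrow x=x\}$, and $\mathsf{IS}(X)=\bigcap_{x\in X}\mathsf{IS}(x)$ for $X\subseteq C$. A coop is semi-cancellative if whenever $x+y=x+z$ and $y\ne z$, the element $x+y$ is an annihilator, i.e. an element $1$ with $u+1=1$ for all $u$ in the coop. If $\mathbf{C}',\mathbf{D}$ are subcoops of a coop $\mathbf{E}$ with carriers $C',D,E$, then $\mathbf{E}$ is the ordinal sum $\mathbf{C}'\frown\mathbf{D}$ iff $C'\cap D=\{0\}$, $C'\cup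 D=E$ and $c+d=d$ whenever $c\in C'$ and $0\neq d\in D$. *)

(* Defs.v *)
From mathcomp Require Import all_boot.
From mathcomp Require Import boolp classical_sets.

Set Implicit Arguments.
Unset Strict Implicit.
Unset Printing Implicit Defensive.

Declare Scope coop_scope.
Delimit Scope coop_scope with coop.

Reserved Notation "x ~> y" (at level 55, right associativity).

Local Open Scope classical_set_scope.
Local Open Scope coop_scope.

(* In a pocrim [0] is the least element and [x >= y] abbreviates
   [x ~> y = 0]. *)
Record pocrim := Pocrim {
  pocrim_sort :> Type;
  zero : pocrim_sort;
  add : pocrim_sort -> pocrim_sort -> pocrim_sort;
  imp : pocrim_sort -> pocrim_sort -> pocrim_sort;
  pc_addA : forall x y z, add (add x y) z = add x (add y z);
  pc_addC : forall x y, add x y = add y x;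
  pc_addx0 : forall x, add x zero = x;
  pc_ge_refl : forall x, imp x x = zero;
  pc_ge_trans : forall x y z, imp x y = zero -> imp y z = zero ->
    imp x z = zero;
  pc_ge_anti : forall x y, imp x y = zero -> imp y x = zero -> x = y;
  pc_ge_add : forall x y z, imp x y = zero ->
    imp (add x z) (add y z) = zero;
  pc_ge0 : forall x, imp x zero = zero;
  pc_resid : forall x y z,
    imp (add x y) z = zero <-> imp x (imp y z) = zero
}.

Arguments zero {p}.
Arguments add {p} x y : rename.
Arguments imp {p} x y : rename.

Definition ge (P : pocrim) (x y : P) : Prop := imp x y = zero.
Definition gt (P : pocrim) (x y : P) : Prop := ge x y /\ x <> y.

Notation "0" := (@zero _) : coop_scope.
Notation "x + y" := (add x y) : coop_scope.
Notation "x ~> y" := (imp x y) : coop_scope.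
Notation "x >= y" := (ge x y) : coop_scope.
Notation "x > y" := (gt x y) : coop_scope.

Record hoop := Hoop {
  hoop_pocrim :> pocrim;
  hoop_natural : forall x y : hoop_pocrim, x >= y -> exists z, x = y + z
}.

Record coop := Coop {
  coop_hoop :> hoop;
  halve : coop_hoop -> coop_hoop;
  halveE : forall x, halve x = halve x ~> x
}.

Arguments halve {c} x : rename.

Lemma hoop_ge_addE (H : hoop) (x y : H) : x >= y -> x = y + (y ~> x).
Proof.
move=> xy; have [z xE] := hoop_natural xy.
have zy : z >= y ~> x.
  by apply/pc_resid; rewrite pc_addC -xE; exact: pc_ge_refl.
apply: pc_ge_anti.
- by rewrite {1}xE pc_addC [y + _]pc_addC; exact: pc_ge_add.
- by rewrite pc_addC; apply/pc_resid; exact: pc_ge_refl.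
Qed.

(* Hoops form a variety, so a subset closed under the operations is the carrier
   of a subcoop: see [coop_of_subcoop]. *)
Record subcoop (C : coop) := Subcoop {
  carrier : set C;
  sub_zero : carrier 0;
  sub_add : forall x y, carrier x -> carrier y -> carrier (x + y);
  sub_imp : forall x y, carrier x -> carrier y -> carrier (x ~> y);
  sub_halve : forall x, carrier x -> carrier (halve x)
}.

Section SubcoopCoop.
Variables (C : coop) (A : subcoop C).

Local Notation T := {x : C | carrier A x}.

Definition subc_zero : T := exist _ 0 (sub_zero A).
Definition subc_add (x y : T) : T :=
  exist _ _ (sub_add (proj2_sig x) (proj2_sig y)).
Definition subc_imp (x y : T) : T :=
  exist _ _ (sub_imp (proj2_sig x) (proj2_sig y)).
Definition subc_halve (x : T) : T := exist _ _ (sub_halve (proj2_sig x)).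

Lemma subc_eq (x y : T) : proj1_sig x = proj1_sig y <-> x = y.
Proof.
by split=> [|-> //]; exact: eq_sig_hprop (fun=> @Prop_irrelevance _) _ _.
Qed.

Lemma subc_ge (x y : T) :
  subc_imp x y = subc_zero <-> proj1_sig x >= proj1_sig y.
Proof. by rewrite -subc_eq. Qed.

Lemma subc_addA x y z :
  subc_add (subc_add x y) z = subc_add x (subc_add y z).
Proof. by apply/subc_eq; exact: pc_addA. Qed.
Lemma subc_addC x y : subc_add x y = subc_add y x.
Proof. by apply/subc_eq; exact: pc_addC. Qed.
Lemma subc_addx0 x : subc_add x subc_zero = x.
Proof. by apply/subc_eq; exact: pc_addx0. Qed.
Lemma subc_ge_refl x : subc_imp x x = subc_zero.
Proof. by apply/subc_eq; exact: pc_ge_refl. Qed.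
Lemma subc_ge_trans x y z :
  subc_imp x y = subc_zero -> subc_imp y z = subc_zero ->
  subc_imp x z = subc_zero.
Proof.
by move=> /subc_ge xy /subc_ge yz; apply/subc_ge; exact: pc_ge_trans xy yz.
Qed.
Lemma subc_ge_anti x y :
  subc_imp x y = subc_zero -> subc_imp y x = subc_zero -> x = y.
Proof.
by move=> /subc_ge xy /subc_ge yx; apply/subc_eq; exact: pc_ge_anti xy yx.
Qed.
Lemma subc_ge_add x y z :
  subc_imp x y = subc_zero ->
  subc_imp (subc_add x z) (subc_add y z) = subc_zero.
Proof. by move=> /subc_ge xy; apply/subc_ge; exact: pc_ge_add. Qed.
Lemma subc_ge0 x : subc_imp x subc_zero = subc_zero.
Proof. by apply/subc_eq; exact: pc_ge0. Qed.
Lemma subc_resid x y z :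
  subc_imp (subc_add x y) z = subc_zero <->
  subc_imp x (subc_imp y z) = subc_zero.
Proof. by rewrite !subc_ge; exact: pc_resid. Qed.

Definition subcoop_pocrim : pocrim :=
  Pocrim subc_addA subc_addC subc_addx0 subc_ge_refl
    subc_ge_trans subc_ge_anti subc_ge_add subc_ge0
    subc_resid.

Lemma subc_natural (x y : subcoop_pocrim) : x >= y -> exists z, x = y + z.
Proof.
move=> /subc_ge xy; exists (subc_imp y x); apply/subc_eq.
exact: hoop_ge_addE.
Qed.

Definition subcoop_hoop : hoop := Hoop subc_natural.

Lemma subc_halveE (x : subcoop_hoop) :
  subc_halve x = imp (subc_halve x : subcoop_hoop) x.
Proof. by apply/subc_eq; exact: halveE. Qed.

Definition coop_of_subcoop : coop := @Coop subcoop_hoop subc_halve subc_halveE.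

End SubcoopCoop.

Coercion coop_of_subcoop : subcoop >-> coop.

Section Notions.
Variable C : coop.

Definition ideal (I : set C) : Prop :=
  [/\ I 0,
      forall x y, I x -> I y -> I (x + y) &
      forall x y, I x -> x >= y -> I y].

Definition congruence (th : C -> C -> Prop) : Prop :=
  ((forall x, th x x) /\
   (forall x y, th x y -> th y x) /\
   (forall x y z, th x y -> th y z -> th x z)) /\
  ((forall x x' y y', th x x' -> th y y' -> th (x + y) (x' + y')) /\
   (forall x x' y y', th x x' -> th y y' -> th (x ~> y) (x' ~> y')) /\
   (forall x x', th x x' -> th (halve x) (halve x'))).

Definition is_identity (th : C -> C -> Prop) : Prop :=
  forall x y, th x y <-> x = y.

(* For the one-element coop the family is empty and this is the total relation,
   which is the identity there: the one-element coop is not subdirectly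
   irreducible. *)
Definition congruence_monolith (x y : C) : Prop :=
  forall th, congruence th -> ~ is_identity th -> th x y.

Definition subdirectly_irreducible : Prop :=
  ~ is_identity congruence_monolith.

Definition monolithic_ideal : set C :=
  \bigcap_(I in [set I : set C | ideal I /\ I <> [set 0]]) I.

Definition IS (x : C) : set C := [set s | s ~> x = x].

Definition ISset (X : set C) : set C := \bigcap_(x in X) IS x.

Definition linearly_ordered (X : set C) : Prop :=
  forall x y, X x -> X y -> x >= y \/ y >= x.

Definition annihilator (e : C) : Prop := forall u : C, u + e = e.

Definition semi_cancellative : Prop :=
  forall x y z : C, x + y = x + z -> y <> z -> annihilator (x + y).

(* [C] is the ordinal sum of its subcoops [A] (below) and [B] (above). *)
Definition ordinal_sum (A B : subcoop C) : Prop :=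
  [/\ carrier A `&` carrier B = [set 0],
      carrier A `|` carrier B = setT &
      forall c d, carrier A c -> carrier B d -> d <> 0 -> c + d = d].

End Notions.

Arguments monolithic_ideal : clear implicits.

(* Main.v *)
Require Import Defs.
From mathcomp Require Import all_boot boolp classical_sets.

(** In any hoop the two differences [x ~> y] and [y ~> x] of a pair are
    orthogonal: [(x ~> y) ~> (y ~> x) = y ~> x] ([imp_imp_swap]).  This identity
    is the engine of the proof.

    It first makes halving compatible with every ideal: halves of congruent
    elements have congruent differences in both directions, and an element
    orthogonal to something congruent to itself lies in the ideal.  Hence every
    ideal is the zero class of a congruence, so subdirect irreducibility makes the
    intersection [M] of all the non-zero ideals non-zero
    ([monolithic_ideal_neq0]).

    From then on everything is driven by the minimality of [M]: an ideal that
    contains a single non-zero element contains [M].  It is applied to the ideals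
    [IS x], to their intersections [ISset X], and to the ideals of the
    elements that a given element absorbs.  A non-zero [x] above no
    non-zero element of [M] would stabilize [M], so [M] would stabilize itself,
    which is absurd ([monolithic_below]).  For
    a non-zero [f] in [F], some non-zero element of [M] below [f] is absorbed by
    [f], hence all of [M] is ([monolithic_absorbed]); so [f ~> x] is again in [F]
    for every [x] ([fixed_imp_fixed]), whence [f >= x] unless [x] is in [F].
    This splits [C] as an ordinal sum.

    Finally, in [S] a non-zero element has no non-zero stabilizer, because [M]
    would be contained in its stabilizer and [S] meets [F] only in [0].  By
    orthogonality one of [x ~> y] and [y ~> x] is then [0] when [x] and [y] are
    in [S], so [S] is a chain.  If cancellation fails at [e] in [S], then [e]
    absorbs a non-zero element, hence absorbs [M], so [e ~> u] is in both [F] and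
    [S] for every [u] in [S]: thus [e] is the top of [S]. *)

Set Implicit Arguments.
Unset Strict Implicit.
Unset Printing Implicit Defensive.

Local Open Scope classical_set_scope.
Local Open Scope coop_scope.

(** * Arithmetic of pocrims *)

Section Pocrims.
Variable P : pocrim.
Implicit Types x y z : P.

Lemma ge_refl x : x >= x.
Proof. exact: pc_ge_refl. Qed.

Lemma ge_trans y x z : x >= y -> y >= z -> x >= z.
Proof. exact: pc_ge_trans. Qed.

Lemma ge_anti x y : x >= y -> y >= x -> x = y.
Proof. exact: pc_ge_anti. Qed.

Lemma ge_impI x y z : x + y >= z -> x >= y ~> z.
Proof. by move/pc_resid. Qed.

Lemma ge_impE x y z : x >= y ~> z -> x + y >= z.
Proof. by move=> xyz; apply/pc_resid. Qed.

Lemma add0x x : 0 + x = x.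
Proof. by rewrite pc_addC pc_addx0. Qed.

Lemma addCA x y z : x + (y + z) = y + (x + z).
Proof. by rewrite -!pc_addA (pc_addC x). Qed.

Lemma addACA x y z t : (x + y) + (z + t) = (x + z) + (y + t).
Proof. by rewrite !pc_addA (addCA y). Qed.

Lemma ge_add2 x x' y y' : x >= x' -> y >= y' -> x + y >= x' + y'.
Proof.
move=> xx' yy'; apply: (@ge_trans (x' + y)); first exact: pc_ge_add.
by rewrite !(pc_addC x'); exact: pc_ge_add.
Qed.

Lemma ge_addl x y : x + y >= x.
Proof. by rewrite -{2}(pc_addx0 x); apply: ge_add2; [exact: ge_refl|exact: pc_ge0]. Qed.

Lemma ge_addr x y : x + y >= y.
Proof. by rewrite pc_addC; exact: ge_addl. Qed.

Lemma ge_imp x y : y >= x ~> y.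
Proof. by apply: ge_impI; exact: ge_addl. Qed.

Lemma ge_add_imp x y : x + (x ~> y) >= y.
Proof. by rewrite pc_addC; apply: ge_impE; exact: ge_refl. Qed.

Lemma ge_imp_add x y : (x ~> y) + x >= y.
Proof. by rewrite pc_addC; exact: ge_add_imp. Qed.

Lemma ge_imp_comp x y z : (y ~> z) + (x ~> y) >= x ~> z.
Proof.
apply: ge_impI; rewrite pc_addA; apply: ge_trans (ge_imp_add y z).
by apply: ge_add2; [exact: ge_refl|exact: ge_imp_add].
Qed.

Lemma imp_monor x y z : y >= z -> x ~> y >= x ~> z.
Proof.
by move=> yz; apply: ge_impI; rewrite pc_addC; exact: ge_trans (ge_add_imp x y) yz.
Qed.

Lemma imp_monol x x' y : x >= x' -> x' ~> y >= x ~> y.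
Proof.
move=> xx'; apply: ge_impI; apply: ge_trans (ge_add_imp x' y).
by rewrite pc_addC; exact: pc_ge_add.
Qed.

Lemma imp_add x y z : (x + y) ~> z = x ~> y ~> z.
Proof.
apply: ge_anti; apply: ge_impI.
  by apply: ge_impI; rewrite pc_addA; apply: ge_impE; exact: ge_refl.
by rewrite -pc_addA; do 2 apply: ge_impE; exact: ge_refl.
Qed.

Lemma imp_swap x y z : x ~> y ~> z = y ~> x ~> z.
Proof. by rewrite -!imp_add pc_addC. Qed.

Lemma imp0x x : 0 ~> x = x.
Proof.
apply: ge_anti; last exact: ge_imp.
by rewrite -{1}(add0x (0 ~> x)); exact: ge_add_imp.
Qed.

End Pocrims.

(** * Joins and orthogonality of differences in hoops *)

Section Hoops.
Variable H : hoop.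
Implicit Types x y z : H.

(** [x + (x ~> y)] is the join of [x] and [y]: natural ordering makes it the
    least upper bound. *)
Lemma add_imp_lub x y z : z >= x -> z >= y -> z >= x + (x ~> y).
Proof.
move=> zx zy; rewrite (hoop_ge_addE zx).
by apply: ge_add2; [exact: ge_refl|exact: imp_monor].
Qed.

Lemma add_impC x y : x + (x ~> y) = y + (y ~> x).
Proof.
by apply: ge_anti; apply: add_imp_lub; (exact: ge_add_imp || exact: ge_addl).
Qed.

(** Let [e] be the part
    [(u ~> v) ~> v] of [v = y ~> x] on which orthogonality to [u = x ~> y] could
    fail.  It lies below [u], [v], [x] and [y], and subtracting it from both [x]
    and [y] changes neither difference; comparing the join of the smaller pair
    with [x] and [y] shows that [u ~> v] is already enough to lift [y] above
    [x]. *)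
Lemma imp_imp_swap x y : (x ~> y) ~> (y ~> x) = y ~> x.
Proof.
set u := x ~> y; set v := y ~> x; set p := u ~> v.
apply: ge_anti; last exact: ge_imp.
set e := p ~> v.
have ve : v >= e by exact: ge_imp.
have ue : u >= e by apply: ge_impI; exact: ge_add_imp.
have yE : y = e + (e ~> y).
  by apply: hoop_ge_addE; apply: ge_trans ue; exact: ge_imp.
have xE : x = e + (e ~> x).
  by apply: hoop_ge_addE; apply: ge_trans ve; exact: ge_imp.
have uE : (e ~> x) ~> (e ~> y) = u by rewrite -imp_add pc_addC -xE.
have vE : (e ~> y) ~> (e ~> x) = v by rewrite -imp_add pc_addC -yE.
have pvE : v = e + p by rewrite pc_addC; exact/hoop_ge_addE/ge_imp.
have joinE : x + (e ~> u) = y + p.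
  rewrite {1}xE pc_addA addCA -(hoop_ge_addE ue) -{1}uE add_impC vE.
  by rewrite pvE addCA -pc_addA -yE.
by apply: ge_impI; rewrite pc_addC -joinE; exact: ge_addl.
Qed.

End Hoops.

(** * Ideals and their congruences *)

Section Ideals.
Variable C : coop.
Implicit Types (x y z s e : C) (I X : set C).

Definition ideal_congruence I x y := I (x ~> y) /\ I (y ~> x).

Lemma ideal_imp I x y : ideal I -> I y -> I (x ~> y).
Proof. by case=> _ _ Idown Iy; exact: Idown (ge_imp _ _). Qed.

Lemma ideal_halve I x : ideal I -> I x -> I (halve x).
Proof. by move=> idI Ix; rewrite halveE; exact: ideal_imp. Qed.

Definition subcoop_of_ideal I (idI : ideal I) : subcoop C :=
  @Subcoop C I (let: And3 I0 _ _ := idI in I0)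
    (let: And3 _ ID _ := idI in ID) (fun x y _ => @ideal_imp I x y idI)
    (fun x => @ideal_halve I x idI).

Lemma ideal_imp_ge I a x y : ideal I -> I a -> a + x >= y -> I (x ~> y).
Proof. by case=> _ _ Idown Ia /ge_impI; exact: Idown. Qed.

(** If [u] and [v] are the halves of [x]
    and [y], then [v ~> u] is [(u + v) ~> x] and [u ~> v] is [(u + v) ~> y], so
    the difference of these two elements is in the ideal; by orthogonality that
    difference is [u ~> v] itself. *)
Lemma ideal_imp_halve I x y : ideal I -> I (x ~> y) -> I (halve x ~> halve y).
Proof.
move=> idI Ixy.
have uvE : halve x ~> halve y = (halve x + halve y) ~> y.
  by rewrite imp_add -halveE.
have vuE : halve y ~> halve x = (halve x + halve y) ~> x.
  by rewrite pc_addC imp_add -halveE.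
rewrite -imp_imp_swap vuE uvE; apply: (ideal_imp_ge idI Ixy).
exact: ge_imp_comp.
Qed.

Lemma ideal_congruenceP I : ideal I -> congruence (ideal_congruence I).
Proof.
move=> idI; have [I0 IDclosed Idown] := idI.
have add_mono x x' y y' : I (x ~> x') -> I (y ~> y') -> I ((x + y) ~> (x' + y')).
  move=> Ix Iy; apply: (ideal_imp_ge idI (IDclosed _ _ Ix Iy)).
  by rewrite addACA; apply: ge_add2; exact: ge_imp_add.
have imp_mono x x' y y' : I (x' ~> x) -> I (y ~> y') ->
    I ((x ~> y) ~> (x' ~> y')).
  move=> Ix Iy; apply: (ideal_imp_ge idI (IDclosed _ _ Ix Iy)).
  rewrite pc_addA pc_addC; apply: ge_trans (ge_imp_comp x' x y').
  by apply: ge_add2; [exact: ge_imp_comp|exact: ge_refl].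
have imp_trans x y z : I (x ~> y) -> I (y ~> z) -> I (x ~> z).
  by move=> Ixy Iyz; exact: Idown (IDclosed _ _ Iyz Ixy) (ge_imp_comp _ _ _).
split; split.
- by move=> x; split; rewrite pc_ge_refl.
- split=> [x y []//|x y z [xy yx] [yz zy]].
  by split; [exact: imp_trans xy yz|exact: imp_trans zy yx].
- by move=> x x' y y' [xx' x'x] [yy' y'y]; split; exact: add_mono.
- split=> [x x' y y' [xx' x'x] [yy' y'y]|x x' [xx' x'x]].
    by split; exact: imp_mono.
  by split; exact: ideal_imp_halve.
Qed.

(** This closure is what allows the minimality of the monolithic ideal to be
    applied to stabilizers: one non-zero stabilizer of [X] gives a whole ideal of
    them, hence the monolithic ideal. *)
Lemma ideal_ISset X : ideal (ISset X).
Proof.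
split=> [x _|s t Ss St x Xx|s t Ss st x Xx]; rewrite /IS /=.
- exact: imp0x.
- by rewrite imp_add (St _ Xx) (Ss _ Xx).
- apply: ge_anti; last exact: ge_imp.
  by rewrite -{2}(Ss _ Xx); exact: imp_monol.
Qed.

Lemma ideal_IS x : ideal (IS x).
Proof.
suff -> : IS x = ISset [set x] by exact: ideal_ISset.
by rewrite /ISset bigcap_set1.
Qed.

Lemma ideal_absorbed e : ideal [set s | s + e = e].
Proof.
split=> [|s t /= se te|s t /= se st]; first exact: add0x.
  by rewrite pc_addA te.
apply: ge_anti; first exact: ge_addr.
by rewrite -{1}se; exact: pc_ge_add.
Qed.

Lemma imp_self0 s : s ~> s = s -> s = 0.
Proof. by rewrite pc_ge_refl. Qed.

(** * The monolithic ideal *)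

Local Notation M := (monolithic_ideal C).

Lemma ideal_monolithic : ideal M.
Proof.
split=> [I [[I0 _ _] _]//|x y Mx My I II|x y Mx xy I II]; have [[_ ID Idown] _] := II.
- by apply: ID; [exact: Mx|exact: My].
- by apply: Idown xy; exact: Mx.
Qed.

Lemma monolithic_ideal_min I s : ideal I -> I s -> s <> 0 -> M `<=` I.
Proof. by move=> idI Is s0 a; apply; split=> // I0; apply: s0; rewrite I0 in Is. Qed.

(** Two distinct elements identified by every non-identity congruence have a
    non-zero difference, which lies in every non-zero ideal. *)
Lemma monolithic_ideal_neq0 : subdirectly_irreducible C ->
  exists a, M a /\ a <> 0.
Proof.
move=> hC; apply: contrapT => noM; apply: hC => x y; split; last first.
  by move=> -> th [[]].
move=> monxy.
have Mxy : M (x ~> y) /\ M (y ~> x).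
  suff th I : ideal I /\ I <> [set 0] -> ideal_congruence I x y.
    by split=> I II; have [] := th I II.
  move=> [idI I0]; apply: monxy; first exact: ideal_congruenceP.
  move=> thid; apply: I0; apply/seteqP; split=> [i Ii|i ->]; last by case: idI.
  apply/(thid i 0); split; last by rewrite imp0x.
  by rewrite pc_ge0; case: idI.
have M0 a : M a -> a = 0.
  by move=> Ma; apply: contrapT => a0; apply: noM; exists a.
by apply: ge_anti; apply: M0; case: Mxy.
Qed.

End Ideals.

(** * The ordinal sum decomposition *)

Section Decomposition.
Variable C : coop.
Hypothesis hC : subdirectly_irreducible C.
Implicit Types a f s x y : C.

Local Notation M := (monolithic_ideal C).
Local Notation F := [set f : C | M `<=` IS f].
Local Notation S := (ISset F).

(** If no such [a] exists, [x] stabilizes every [b] in [M]: the witness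
    [(x ~> b) ~> b] is below both [x] and [b], so it is zero, which means
    [x ~> b = b].  By minimality [M] then stabilizes its own elements, although
    [m ~> m = 0]. *)
Lemma monolithic_below x : x <> 0 -> exists a, M a /\ a <> 0 /\ x >= a.
Proof.
move=> x0; have [m [Mm m0]] := monolithic_ideal_neq0 hC.
apply: contrapT => none.
have ISx : ISset M x.
  move=> b Mb; apply: contrapT => xb; apply: none; exists ((x ~> b) ~> b).
  split; first exact: ideal_imp (ideal_monolithic C) Mb.
  split; last by apply: ge_impI; exact: ge_add_imp.
  by move=> xbb; apply: xb; apply: ge_anti => //; exact: ge_imp.
have := monolithic_ideal_min (ideal_ISset M) ISx x0 Mm _ Mm.
by move/imp_self0.
Qed.

(** [f] absorbs every stabilizer of [f] below [f]; there is a non-zero one in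
    [M], and the elements absorbed by [f] form an ideal. *)
Lemma monolithic_absorbed a f : M a -> F f -> f <> 0 -> a + f = f.
Proof.
move=> Ma Ff f0; have [b [Mb [b0 fb]]] := monolithic_below f0.
apply: (monolithic_ideal_min (ideal_absorbed f) _ b0 Ma).
by rewrite /= [RHS](hoop_ge_addE fb) (Ff _ Mb).
Qed.

Lemma fixed_ge_monolithic f a : F f -> f <> 0 -> M a -> f >= a.
Proof. by move=> Ff f0 Ma; rewrite -(monolithic_absorbed Ma Ff f0); exact: ge_addl. Qed.

Lemma fixed_up f x : F f -> f <> 0 -> x >= f -> F x.
Proof.
move=> Ff f0 xf a Ma; rewrite /IS /=.
have xa : x >= a := ge_trans xf (fixed_ge_monolithic Ff f0 Ma).
rewrite [RHS](hoop_ge_addE xa).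
have yf : a ~> x >= f by rewrite -{1}(Ff _ Ma); exact: imp_monor.
(* Being above [f], the element [a ~> x] absorbs [a], as [f] does. *)
by rewrite (hoop_ge_addE yf) -pc_addA (monolithic_absorbed Ma Ff f0).
Qed.

Lemma fixed_imp x f : F f -> F (x ~> f).
Proof. by move=> Ff a Ma; rewrite /IS /= imp_swap (Ff _ Ma). Qed.

(** For [a] in [M], [f] absorbs [(a ~> x) ~> x], whose difference to [x] is
    [a ~> x]; so [f ~> x] and [f ~> (a ~> x)] agree. *)
Lemma fixed_imp_fixed f x : F f -> f <> 0 -> F (f ~> x).
Proof.
move=> Ff f0 a Ma; rewrite /IS /= imp_swap.
set y := (a ~> x) ~> x.
have My : M y.
  case: (ideal_monolithic C) => _ _ Mdown; apply: Mdown Ma _.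
  by apply: ge_impI; exact: ge_add_imp.
have yx : y ~> x = a ~> x.
  apply: ge_anti; last by apply: ge_impI; exact: ge_add_imp.
  by apply: imp_monol; apply: ge_impI; exact: ge_add_imp.
by rewrite -yx -imp_add pc_addC monolithic_absorbed.
Qed.

(** [f ~> x] is in [F] and below [x], so if it were non-zero then [x] would be
    in [F], which is upward closed away from [0]. *)
Lemma fixed_gt f x : F f -> f <> 0 -> ~ F x -> f > x.
Proof.
move=> Ff f0 Fx; split; last by move=> fx; rewrite fx in Ff.
apply: contrapT => fx; apply: Fx.
by apply: fixed_up (fixed_imp_fixed x Ff f0) fx _; exact: ge_imp.
Qed.

Lemma fixed0 : F 0.
Proof. by move=> a _; exact: pc_ge0. Qed.

Lemma fixed_add f g : F f -> F g -> F (f + g).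
Proof.
move=> Ff Fg; have [->|f0] := pselect (f = 0); first by rewrite add0x.
by apply: fixed_up Ff f0 _; exact: ge_addl.
Qed.

Lemma fixed_halve f : F f -> F (halve f).
Proof. by rewrite halveE; exact: fixed_imp. Qed.

Definition fixed_subcoop : subcoop C :=
  Subcoop fixed0 fixed_add (fun x f _ => @fixed_imp x f) fixed_halve.

Definition stab_subcoop : subcoop C := subcoop_of_ideal (ideal_ISset F).

Lemma stab_fixed0 s : S s -> F s -> s = 0.
Proof. by move=> Ss Fs; exact/imp_self0/Ss. Qed.

(** A non-zero [s] stabilizing [x] would make all of [M] stabilize [x], by
    minimality, and put [x] in both [S] and [F]. *)
Lemma stab_IS0 s x : S x -> x <> 0 -> s ~> x = x -> s = 0.
Proof.
move=> Sx x0 sx; apply: contrapT => s0; apply: x0; apply: stab_fixed0 => //.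
exact: monolithic_ideal_min (ideal_IS x) sx s0.
Qed.

Lemma stab_linear : linearly_ordered S.
Proof.
move=> x y Sx Sy; have [yx0|yx0] := pselect (y ~> x = 0); first by right.
left; apply: stab_IS0 yx0 (imp_imp_swap x y).
exact: ideal_imp (ideal_ISset F) Sx.
Qed.

(** An element of [S] absorbing a non-zero element absorbs [M], so its
    differences to the elements of [S] are fixed by [M], hence zero. *)
Lemma stab_top e t u : S e -> S u -> t <> 0 -> t + e = e -> e >= u.
Proof.
move=> Se Su t0 te; apply: stab_fixed0.
  exact: ideal_imp (ideal_ISset F) Su.
move=> a Ma; rewrite /IS /= -imp_add.
by rewrite (monolithic_ideal_min (ideal_absorbed e) te t0 Ma).
Qed.

(** As [S] is a chain, [z = y + (y ~> z)] up to symmetry, so [x + y] absorbs the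
    non-zero element [y ~> z]. *)
Lemma stab_cancel x y z u : S x -> S y -> S z -> S u ->
  x + y = x + z -> y <> z -> x + y >= u.
Proof.
have [_ SD _] := ideal_ISset F.
move=> Sx Sy Sz Su; wlog zy : y z Sy Sz / z >= y => [hwlog|xyz yz].
  move=> xyz yz; have [yz'|zy] := stab_linear Sy Sz; last exact: hwlog zy xyz yz.
  by rewrite xyz; apply: hwlog yz' (esym xyz) (nesym yz).
have t0 : y ~> z <> 0 by move=> yz'; apply: yz; exact: ge_anti.
apply: (stab_top (SD _ _ Sx Sy) Su t0).
by rewrite addCA (pc_addC (y ~> z)) -hoop_ge_addE.
Qed.

Lemma stab_semi_cancellative : semi_cancellative stab_subcoop.
Proof.
move=> x y z xyz yz u; apply/subc_eq; apply: ge_anti; first exact: ge_addr.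
have xyz' := congr1 (@proj1_sig _ _) xyz.
have yz' : proj1_sig y <> proj1_sig z by move=> /subc_eq.
exact: (stab_cancel (proj2_sig x) (proj2_sig y) (proj2_sig z)
  (proj2_sig (u + (x + y))) xyz' yz').
Qed.

(** For [f] in [F], the excess [(x ~> f) ~> f] is in [F] but below [x]; since
    every non-zero element of [F] is strictly above [x], it is zero. *)
Lemma stab_of_not_fixed x : ~ F x -> S x.
Proof.
move=> Fx f Ff; rewrite /IS /=; apply: ge_anti; last exact: ge_imp.
apply: contrapT => e0.
have [ex exN] := fixed_gt (fixed_imp (x ~> f) Ff) e0 Fx.
apply: exN; apply: ge_anti => //.
by apply: ge_impI; exact: ge_add_imp.
Qed.

Lemma ordinal_sum_stab_fixed : ordinal_sum stab_subcoop fixed_subcoop.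
Proof.
have [S0 _ _] := ideal_ISset F.
split=> /= [||c d Sc Fd d0].
- apply/seteqP; split=> [s [Ss Fs]|s ->]; first exact: stab_fixed0.
  by split; [exact: S0|exact: fixed0].
- apply/seteqP; split=> // x _.
  by have [Fx|Fx] := pselect (F x); [right|left; exact: stab_of_not_fixed].
- have dc : d >= c.
    have [Fc|Fc] := pselect (F c); last by have [] := fixed_gt Fd d0 Fc.
    by rewrite (stab_fixed0 Sc Fc); exact: pc_ge0.
  by rewrite [RHS](hoop_ge_addE dc) (Sc _ Fd).
Qed.

End Decomposition.

Theorem theorem26 (C : coop) (hC : subdirectly_irreducible C) :
  let M : set C := monolithic_ideal C in
  let F : set C := [set f | M `<=` IS f] in
  let S : set C := ISset F in
  (* (i) *)
  (forall x : C, x <> 0 -> exists a : C, M a /\ a <> 0 /\ x >= a) /\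
  (* (ii) *)
  (forall f a : C, F f -> f <> 0 -> M a -> f >= a) /\
  (* (iii) *)
  (forall a f : C, M a -> F f -> f <> 0 -> a + f = f) /\
  (* (iv) *)
  (forall f x : C, F f -> f <> 0 -> x >= f -> F x) /\
  (* (v) *)
  (forall x f : C, F f -> F (x ~> f)) /\
  (* (vi) *)
  (forall f x : C, F f -> f <> 0 -> ~ F x -> f > x) /\
  (* (vii)-(x): FF and SS are the subcoops with carriers F and S *)
  exists FF SS : subcoop C,
    (* (vii) *)
    carrier FF = F /\
    (* (viii) *)
    (ideal S /\ linearly_ordered S /\ S `&` F = [set 0]) /\
    (* (ix) *)
    (carrier SS = S /\ semi_cancellative SS) /\
    (* (x) *)
    ordinal_sum SS FF.
Proof.
move=> M F S.
split; first exact: monolithic_below.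
split; first by move=> f a; exact: fixed_ge_monolithic.
split; first exact: monolithic_absorbed.
split; first exact: fixed_up.
split; first exact: fixed_imp.
split; first exact: fixed_gt.
exists (fixed_subcoop hC), (stab_subcoop C).
have sumSF := ordinal_sum_stab_fixed hC.
split=> //; split; last by split=> //; split=> //; exact: stab_semi_cancellative.
split; first exact: ideal_ISset.
by split; [exact: stab_linear|case: sumSF].
Qed.
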